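(* Suppose that for every $n$ the sequence $(X_{n,i})_{1\le i\le n}$ is stationary, that $r_n/s_n\in\mathbb N$ for all $n\in\mathbb N$, and that the limits $$c^{(s)}=\lim_{n\to\infty}\frac1{r_nv_ns_n^2a_n^2}\mathrm{Var}\Big(\sum_{i=1}^{r_n}g(Y_{n,i})\Big)\in(0,\infty),\qquad c^{(d)}=\lim_{n\to\infty}\frac1{r_nv_na_n^2}\mathrm{Var}\Big(\sum_{i=1}^{r_n/s_n}g(Y_{n,is_n+1})\Big)$$ exist. Then $c^{(s)}\le c^{(d)}$.
   Context: $(E,\|\cdot\|)$ is a complete normed vector space, $E_\cup:=\bigcup_{k\in\mathbb N}E^k$, and $(X_{n,i})_{1\le i\le n,\,n\in\mathbb N}$ is a triangular array of $E$-valued random variables. $s_n,r_n\in\mathbb N$ are sequences with $s_n=o(r_n)$ and $r_n=o(n)$; $Y_{n,j}:=(X_{n,j},\dots,X_{n,j+s_n-1})$ are blocks of length $s_n$; $v_n:=P\{X_{n,1}\ne0\}$ with $v_n>0$, $v_n\to0$; $a_n>0$ are normalizing constants. $g:E_\cup\to\mathbb R$ is a measurable functional which vanishes on null vectors. (The constants $c^{(s)}$ and $c^{(d)}$ are the asymptotic variances of the sliding blocks statistic $T_n^s(g)=\frac1{nv_ns_na_n}\sum_{i=1}^{n-s_n+1}g(Y_{n,i})$ and of the disjoint blocks statistic $T_n^d(g)=\frac1{nv_na_n}\sum_{i=1}^{\lfloor n/s_n\rfloor}g(Y_{n,(i-1)s_n+1})$, respectively, both normalized by $\sqrt{nv_n}$.)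 *)

(* Defs.v *)
From HB Require Import structures.
From mathcomp Require Import all_boot all_order all_algebra.
From mathcomp Require Import all_classical all_reals all_analysis.

Set Implicit Arguments.
Unset Strict Implicit.
Unset Printing Implicit Defensive.

Import Order.TTheory GRing.Theory Num.Theory.
Import numFieldNormedType.Exports.

Local Open Scope classical_set_scope.
Local Open Scope ring_scope.

(* E with its Borel sigma-field; [k.-tuple (borelType E)] then carries the
   product sigma-field, which is the Borel one when E is separable. *)
Definition borelType (R : realType) (E : completeNormedModType R) :=
  g_sigma_algebraType (@open E).

(* The vector (X_j, ..., X_{j+k-1}).  Rows of a triangular array are indexed
   from 1: only X_1, ..., X_n are meaningful in the n-th row. *)
Definition block (Omega T : Type) (X : nat -> Omega -> T) (k j : nat)
    (w : Omega) : k.-tuple T :=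
  [tuple X (j + i)%N w | i < k].

Section Defs.
Context (R : realType) (E : completeNormedModType R).

(* The disjoint union of the E^k, k >= 1, is represented by the nonempty
   sequences over E; g is measurable for the disjoint-union sigma-field iff
   its restriction to each E^k is measurable. *)
Definition measurable_functional (g : seq E -> R) : Prop :=
  forall k : nat, (0 < k)%N ->
    measurable_fun [set: k.-tuple (borelType E)]
      (fun y : k.-tuple (borelType E) => g y).

Definition vanishes_on_null (g : seq E -> R) : Prop :=
  forall k : nat, (0 < k)%N -> g (nseq k 0) = 0.

Context (d : measure_display) (Omega : measurableType d)
  (P : probability Omega R).

Definition random_row (n : nat) (X : nat -> Omega -> E) : Prop :=
  forall i : nat, (0 < i <= n)%N ->
    measurable_fun [set: Omega] (X i : Omega -> borelType E).

Definition stationary_row (n : nat) (X : nat -> Omega -> E) : Prop :=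
  forall k h : nat, (h + k <= n)%N ->
    forall A : set (k.-tuple (borelType E)), measurable A ->
      P [set w | A (block X k h.+1 w)] = P [set w | A (block X k 1 w)].

Definition prob_nonzero (Z : Omega -> E) : R :=
  fine (P [set w | Z w != 0]).

End Defs.

(* Main.v *)
(** The sliding blocks sum over [r = m s] indices splits, according to the
residue of the index modulo [s], into [s] sums over disjoint blocks.  Each of
these is the same functional of a vector of [r] consecutive observations, so
by stationarity they all have the law of the disjoint blocks sum.
Cauchy-Schwarz for the [s] centred summands then gives
[Var (sliding) <= s^2 Var (disjoint)] as soon as [r + s <= n], and the
normalizations differ by exactly [s^2].  If the disjoint blocks sum is not
square integrable, its variance is [+oo] and there is nothing to prove. *)

Require Import Defs.
From HB Require Import structures.
From mathcomp Require Import all_boot all_order all_algebra.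
From mathcomp Require Import all_classical all_reals all_analysis.
From mathcomp Require Import measurable_realfun.
From mathcomp Require Import lra zify.

Import Order.TTheory GRing.Theory Num.Theory.
Import numFieldNormedType.Exports.

Local Open Scope classical_set_scope.
Local Open Scope ring_scope.

(** * Cauchy-Schwarz and variances of sums *)

Lemma sqr_sum_le (R : realDomainType) (m : nat) (x : 'I_m -> R) :
  (\sum_(k < m) x k) ^+ 2 <= m%:R * \sum_(k < m) x k ^+ 2.
Proof.
elim: m x => [|m IH] x; first by rewrite !big_ord0 expr0n mul0r.
rewrite !big_ord_recr /=.
move: (IH (fun k => x (widen_ord (leqnSn m) k))) => /=.
set S := \sum_(k < m) _; set Q := \sum_(k < m) _; set y := x ord_max => SQ.
(* Sum of [2 z y <= z ^+ 2 + y ^+ 2] over the first [m] entries [z]. *)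
have cross : 2 * (S * y) <= Q + m%:R * y ^+ 2.
  have -> : m%:R * y ^+ 2 = \sum_(k < m) y ^+ 2.
    by rewrite sumr_const card_ord mulr_natl.
  rewrite /S /Q -big_split /= mulr_suml mulr_sumr; apply: ler_sum => k _.
  set z := x _; have := sqr_ge0 (z - y); lra.
by rewrite -natr1; nra.
Qed.

Section variance.
Context (R : realType) (d : measure_display) (Omega : measurableType d)
  (P : probability Omega R).

Lemma variance_integralE (U : Omega -> R) :
  ('V_P[U] = \int[P]_w ((U w - fine 'E_P[U]) ^+ 2)%:E)%E.
Proof. by rewrite /variance covariance.unlock expectation.unlock. Qed.

(** ['V_P[U]] makes sense even without a finite mean, [fine] then giving a default centring
    constant. Whatever that constant [c] is, square integrability of [U - c] under a probability
    forces integrability of [U]. *)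
Lemma variance_lty_integrable (U : Omega -> R) :
  measurable_fun [set: Omega] U -> ('V_P[U] < +oo)%E ->
  P.-integrable [set: Omega] (EFin \o U).
Proof.
move=> mU; rewrite variance_integralE; set c := fine _ => Uoo.
have mU2 : measurable_fun [set: Omega] (fun w => (U w - c) ^+ 2).
  by apply: measurable_funX; exact: measurable_funB.
(* The dominating function comes from [t <= 1 + t ^+ 2] with [t = |U w - c|]. *)
apply: (@le_integrable _ _ _ _ _ measurableT _
    (fun w => (`|c| + 1)%:E + ((U w - c) ^+ 2)%:E)%E).
- exact/measurable_EFinP.
- move=> w _ /=; rewrite lee_fin.
  apply: le_trans (ler_norm _).
  rewrite -{1}(subrK c (U w)); apply: le_trans (ler_normD _ _) _.
  rewrite -[(U w - c) ^+ 2]real_normK ?num_real//.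
  have := normr_ge0 (U w - c); set t := `|U w - c|; nra.
- apply: integrableD => //.
    exact: finite_measure_integrable_cst.
  apply/integrableP; split; first exact/measurable_EFinP.
  by under eq_integral do rewrite gee0_abs ?lee_fin ?sqr_ge0//.
Qed.

(** Pointwise Cauchy-Schwarz for the centred summands, then integration; the summands may be
    arbitrarily dependent. The bound [V] may be [+oo], so no integrability has to be assumed. *)
Lemma variance_sum_le (m : nat) (S : 'I_m -> Omega -> R) (V : \bar R) :
  (forall k, measurable_fun [set: Omega] (S k)) ->
  (forall k, ('V_P[S k] <= V)%E) -> (0 <= V)%E ->
  ('V_P[(fun w => \sum_(k < m) S k w)%R] <= (m%:R ^+ 2)%:E * V)%E.
Proof.
move=> mS SV V0.
case: (posnP m) => [m0|m0].
  rewrite (_ : (fun _ => _) = cst 0).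
    by rewrite variance_cst mule_ge0// lee_fin sqr_ge0.
  by apply/funext => w; rewrite big1// => k; have := ltn_ord k; rewrite {2}m0.
have [Voo|Voo] := eqVneq V +oo%E.
  by rewrite Voo gt0_muley ?leey// lte_fin exprn_gt0// ltr0n.
(* With [V] finite every summand is integrable, hence the centring constants add up. *)
have intS k : P.-integrable [set: Omega] (EFin \o S k).
  apply: variance_lty_integrable => //.
  by apply: le_lt_trans (SV k) _; rewrite ltey.
pose c k := fine 'E_P[S k]%E.
have EcE : fine 'E_P[(fun w => \sum_(k < m) S k w)%R]%E = \sum_(k < m) c k.
  rewrite /c sum_fine => [|k _]; last first.
    by apply: expectation_fin_num; exact/Lfun1_integrable.
  congr fine; rewrite expectation.unlock.
  by under eq_integral do rewrite -sumEFin; rewrite integral_sum.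
rewrite variance_integralE EcE.
have mc k : measurable_fun [set: Omega] (fun w => (S k w - c k) ^+ 2).
  by apply: measurable_funX; exact: measurable_funB.
apply: (@le_trans _ _
  (\int[P]_w (m%:R%:E * \sum_(k < m) ((S k w - c k) ^+ 2)%:E))%E).
  apply: ge0_le_integral => //.
  - by move=> w _; rewrite lee_fin sqr_ge0.
  - apply/measurable_EFinP; apply: measurable_funX.
    apply: measurable_funB => //; exact: measurable_sum.
  - apply: emeasurable_funM => //; apply: emeasurable_sum => k.
    exact/measurable_EFinP.
  - move=> w _; rewrite sumEFin -EFinM lee_fin -sumrB.
    exact: sqr_sum_le.
rewrite ge0_integralZl//; last 2 first.
- by apply: emeasurable_sum => k; exact/measurable_EFinP.
- by move=> w _; apply: sume_ge0 => k _; rewrite lee_fin sqr_ge0.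
rewrite ge0_integral_sum//; last 2 first.
- by move=> k; exact/measurable_EFinP.
- by move=> k w _; rewrite lee_fin sqr_ge0.
(* One factor [m] is due to Cauchy-Schwarz, the other to the number of summands. *)
rewrite expr2 EFinM -muleA; apply: lee_wpmul2l; first by rewrite lee_fin.
apply: (@le_trans _ _ (\sum_(k < m) V)%E).
  by apply: lee_sum => k _; rewrite -variance_integralE.
have Vfin : V \is a fin_num by rewrite ge0_fin_numE// ltey.
by rewrite -(fineK Vfin) sumEFin sumr_const card_ord -EFinM mulr_natl.
Qed.

(** * Transfer of moments along equality in law *)

Section same_law.
Context (d' : measure_display) (T : measurableType d') (U V : Omega -> T).
Hypotheses (mU : measurable_fun [set: Omega] U)
  (mV : measurable_fun [set: Omega] V)
  (UV : forall A, measurable A -> P [set w | A (U w)] = P [set w | A (V w)]).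

Lemma ge0_integral_same_law (f : T -> \bar R) :
  measurable_fun [set: T] f -> (forall x, 0 <= f x)%E ->
  (\int[P]_w f (U w) = \int[P]_w f (V w))%E.
Proof.
move=> mf f0.
have := ge0_integral_pushforward mU P measurableT mf (fun x _ => f0 x).
have := ge0_integral_pushforward mV P measurableT mf (fun x _ => f0 x).
rewrite !preimage_setT => <- <-.
(* Bundling [U] and [V] as measurable functions makes their pushforwards measures, which can then be
   compared set by set. *)
pose mfU := isMeasurableFun.Build _ _ _ _ _ mU.
pose pU : {mfun _ >-> _} := HB.pack U mfU.
pose mfV := isMeasurableFun.Build _ _ _ _ _ mV.
pose pV : {mfun _ >-> _} := HB.pack V mfV.
rewrite -[LHS]/(\int[pushforward P pU]_x f x)%E.
rewrite -[RHS]/(\int[pushforward P pV]_x f x)%E.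
by apply: eq_measure_integral => A mA _; exact: UV.
Qed.

Lemma expectation_same_law (f : T -> R) :
  measurable_fun [set: T] f -> ('E_P[f \o U] = 'E_P[f \o V])%E.
Proof.
move=> mf; rewrite expectation.unlock.
have mEf : measurable_fun [set: T] (EFin \o f) by exact/measurable_EFinP.
rewrite integralE [RHS]integralE.
congr (_ - _)%E.
  rewrite (funepos_comp (EFin \o f) U) (funepos_comp (EFin \o f) V).
  by apply: ge0_integral_same_law => //; exact: measurable_funepos.
rewrite (funeneg_comp (EFin \o f) U) (funeneg_comp (EFin \o f) V).
by apply: ge0_integral_same_law => //; exact: measurable_funeneg.
Qed.

(** Equal means give the same centring constant, so both variances integrate one nonnegative
    function of [U] and of [V]. *)
Lemma variance_same_law (f : T -> R) :
  measurable_fun [set: T] f -> ('V_P[f \o U] = 'V_P[f \o V])%E.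
Proof.
move=> mf; rewrite !variance_integralE expectation_same_law//.
set c := fine _.
apply: (ge0_integral_same_law (fun x => ((f x - c) ^+ 2)%:E)).
  by apply/measurable_EFinP; apply: measurable_funX; exact: measurable_funB.
by move=> x; rewrite lee_fin sqr_ge0.
Qed.

End same_law.

End variance.

(** * Residue classes and blocks within one row *)

(** Euclidean division by [s] of the index minus one, since indices start at 1. *)
Lemma sum_residues (V : nmodType) (s m : nat) (F : nat -> V) :
  \sum_(1 <= i < (m * s).+1) F i =
  \sum_(k < s) \sum_(i < m) F (i * s + k.+1)%N.
Proof.
rewrite big_add1 /= big_nat_mul exchange_big big_mkord /=.
apply: eq_bigr => i _.
rewrite -[X in \sum_(X <= _ < _) _]add0n big_addn mulSn addnK big_mkord.
by apply: eq_bigr => k _; rewrite addnC -addnS.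
Qed.

Section blocks.
Context (R : realType) (E : completeNormedModType R) (d : measure_display)
  (Omega : measurableType d) (P : probability Omega R).
Implicit Types (X : nat -> Omega -> E) (g : seq E -> R).

(* Entries beyond the end of [z] are read as [0]. *)
Definition window {r : nat} (s j : nat) (z : r.-tuple (borelType E)) :
    s.-tuple (borelType E) :=
  [tuple nth (0 : E) z (j + t)%N | t < s].

Lemma measurable_window (r s j : nat) :
  measurable_fun [set: r.-tuple (borelType E)]
    (window s j : r.-tuple (borelType E) -> s.-tuple (borelType E)).
Proof.
apply/measurable_fun_tnthP => t.
rewrite (_ : _ \o _ =
    fun z : r.-tuple (borelType E) => nth (0 : E) z (j + t)%N).
  have [jr|rj] := ltnP (j + t) r.
    rewrite (_ : (fun _ => _) =
        fun z : r.-tuple (borelType E) => tnth z (Ordinal jr)).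
      exact: measurable_tnth.
    by apply/funext => z; rewrite (tnth_nth (0 : E)).
  rewrite (_ : (fun _ => _) = cst (0 : E)); first exact: measurable_cst.
  by apply/funext => z; rewrite nth_default// size_tuple.
by apply/funext => z /=; rewrite tnth_mktuple.
Qed.

Lemma window_block X (r s j h : nat) (w : Omega) : (j + s <= r)%N ->
  window s j (block X r h w) = block X s (h + j) w.
Proof.
move=> jsr; apply: eq_from_tnth => t; rewrite !tnth_mktuple.
have jtr : (j + t < r)%N by rewrite (leq_trans _ jsr)// ltn_add2l.
by rewrite -[(j + t)%N]/(nat_of_ord (Ordinal jtr)) nth_mktuple /= addnA.
Qed.

Lemma measurable_block X (n k h : nat) :
  random_row n X -> (0 < h)%N -> (h + k <= n.+1)%N ->
  measurable_fun [set: Omega] (block X k h : Omega -> k.-tuple (borelType E)).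
Proof.
move=> mX h0 hkn; apply/measurable_fun_tnthP => t.
rewrite (_ : _ \o _ = (X (h + t)%N : Omega -> borelType E)).
  (* The last index read is [h + k - 1], whence the bound [n.+1]. *)
  by apply: mX; have := ltn_ord t; lia.
by apply/funext => w /=; rewrite tnth_mktuple.
Qed.

(** A bound for a single row. The last disjoint block starts at [m * s + 1], so it ends at
    [m * s + s], which must not exceed [n]. *)
Lemma variance_sliding_le X g (n s m : nat) :
  (0 < s)%N -> random_row n X -> stationary_row P n X ->
  measurable_functional g -> (m * s + s <= n)%N ->
  ('V_P[(fun w => \sum_(1 <= i < (m * s).+1) g (block X s i w))%R] <=
   (s%:R ^+ 2)%:E *
   'V_P[(fun w => \sum_(1 <= i < m.+1) g (block X s (i * s + 1) w))%R])%E.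
Proof.
move=> s0 mX sX mg msn.
(* The disjoint blocks sum as a function of [m * s] consecutive observations, the form to which
   stationarity applies. *)
pose G (z : (m * s).-tuple (borelType E)) : R :=
  \sum_(i < m) g (window s (i * s) z).
have mG : measurable_fun [set: (m * s).-tuple (borelType E)] G.
  apply: measurable_sum => i.
  apply: (measurableT_comp (mg s s0)); exact: measurable_window.
have GE h w :
    G (block X (m * s) h w) = \sum_(i < m) g (block X s (h + i * s) w).
  apply: eq_bigr => i _; rewrite window_block// -mulSnr leq_mul2r.
  by rewrite ltn_ord orbT.
have mB h : (h <= s)%N -> measurable_fun [set: Omega]
    (block X (m * s) h.+1 : Omega -> (m * s).-tuple (borelType E)).
  by move=> hs; apply: (measurable_block X n) => //; lia.
(* Shifts [h < s] serve the residue classes; [h = s] serves the disjoint blocks sum, whose first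
   block starts at [s + 1]. *)
have lawB h : (h <= s)%N ->
    ('V_P[G \o block X (m * s) h.+1] = 'V_P[G \o block X (m * s) 1])%E.
  move=> hs; apply: variance_same_law => //; [exact: mB|exact: mB|].
  by move=> A mA; apply: sX => //; lia.
have -> : (fun w => \sum_(1 <= i < (m * s).+1) g (block X s i w)) =
    (fun w => \sum_(k < s) (G \o block X (m * s) k.+1) w).
  apply/funext => w; rewrite sum_residues; apply: eq_bigr => k _.
  by rewrite /= GE; apply: eq_bigr => i _; rewrite addnC.
have -> : (fun w => \sum_(1 <= i < m.+1) g (block X s (i * s + 1) w)) =
    G \o block X (m * s) s.+1.
  apply/funext => w; rewrite /= GE big_add1 big_mkord.
  by apply: eq_bigr => i _; congr (g (block X s _ w));
     rewrite mulSn addn1 addSn.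
apply: variance_sum_le => [k|k|]; last exact: variance_ge0.
  by apply: (measurableT_comp mG); apply: mB; exact: ltnW.
by rewrite !lawB// ltnW.
Qed.

End blocks.

Theorem theorem2p5 (R : realType) (E : completeNormedModType R)
  (d : measure_display) (Omega : measurableType d) (P : probability Omega R)
  (X : nat -> nat -> Omega -> E) (s r : nat -> nat) (a : nat -> R)
  (g : seq E -> R) (cs : R) (cd : \bar R)
  (Y := fun n j => block (X n) (s n) j)
  (v := fun n => prob_nonzero P (X n 1%N))
  (hX : forall n, (0 < n)%N -> random_row n (X n))
  (hs : forall n, (0 < n)%N -> (0 < s n)%N)
  (hr : forall n, (0 < n)%N -> (0 < r n)%N)
  (hsr : (fun n => (s n)%:R : R) =o_\oo (fun n => (r n)%:R : R))
  (hrn : (fun n => (r n)%:R : R) =o_\oo (fun n => n%:R : R))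
  (hv_gt0 : forall n, (0 < n)%N -> 0 < v n)
  (hv_cvg : v @ \oo --> 0)
  (ha : forall n, (0 < n)%N -> 0 < a n)
  (hg : measurable_functional g)
  (hg0 : vanishes_on_null g)
  (hstat : forall n, (0 < n)%N -> stationary_row P n (X n))
  (hdiv : forall n, (0 < n)%N -> (s n %| r n)%N)
  (hcs_gt0 : 0 < cs)
  (hcs : (((r n)%:R * v n * (s n)%:R ^+ 2 * a n ^+ 2)^-1%:E *
          'V_P[fun w => (\sum_(1 <= i < (r n).+1) g (Y n i w))%R])%E
         @[n --> \oo] --> cs%:E)
  (hcd : (((r n)%:R * v n * a n ^+ 2)^-1%:E *
          'V_P[fun w =>
            (\sum_(1 <= i < (r n %/ s n).+1) g (Y n (i * s n + 1)%N w))%R])%E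
         @[n --> \oo] --> cd) :
  (cs%:E <= cd)%E.
Proof.
(* It suffices to compare the two normalized variances for all large [n]. *)
rewrite -(cvg_lim (@ereal_hausdorff R) hcs) -(cvg_lim (@ereal_hausdorff R) hcd).
apply: lee_lim; [exact: cvgP hcs|exact: cvgP hcd|].
(* Eventually [s n <= r n] and [r n <= n / 2]. *)
have small : \forall n \near \oo, (r n + s n <= n)%N.
  have half : 0 < 2^-1 :> R by rewrite invr_gt0.
  move/eqoP : hsr => /(_ _ ltr01) => sr.
  move/eqoP : hrn => /(_ _ half) => rn.
  near=> n.
  have : `|(s n)%:R : R| <= 1 * `|(r n)%:R| by near: n.
  have : `|(r n)%:R : R| <= 2^-1 * `|n%:R| by near: n.
  rewrite !normr_nat mul1r -(ler_nat R) natrD => ? ?; lra.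
near=> n.
have n0 : (0 < n)%N by near: n; exists 1%N.
have rsn : (r n + s n <= n)%N by near: n; exact: small.
have rs : (r n = r n %/ s n * s n)%N by rewrite divnK// hdiv.
have := @variance_sliding_le _ _ _ _ P (X n) g n (s n) (r n %/ s n)
  (hs _ n0) (hX _ n0) (hstat _ n0) hg.
rewrite -rs => /(_ rsn) VV.
have sn0 : (s n)%:R != 0 :> R by rewrite pnatr_eq0 -lt0n hs.
have coef0 : 0 < (r n)%:R * v n * a n ^+ 2.
  by rewrite !mulr_gt0 ?ltr0n ?hr ?hv_gt0 ?exprn_gt0 ?ha.
(* The factor [s n ^+ 2] of the variance bound cancels against the one in the sliding
   normalization. *)
apply: le_trans (lee_wpmul2l _ VV) _.
  by rewrite lee_fin invr_ge0 mulrAC mulr_ge0 ?sqr_ge0// ltW.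
by rewrite muleA -EFinM mulrAC invfM divfK// expf_neq0.
Unshelve. all: by end_near.
Qed.
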